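(* Let $(X,d)$ be a complete metric space, let $m\ge 2$, and let $\mathcal{S}=(X^{m},(\phi_j)_{j\in\{1,\dots,n\}})$ be a generalized iterated function system consisting of Lipschitz contractions $\phi_j:X^m\to X$, with attractor $A_{\mathcal S}$. Then the evaluation map $ev_{\mathcal S}:\mathcal B^*(X)\to\mathcal B^*(X)$, $ev_{\mathcal S}(B)=A_{\mathcal R_B}$, is a Lipschitz contraction for the Hausdorff-Pompeiu metric $h$ with $\operatorname{Lip}(ev_{\mathcal S})\le \operatorname{Lip}(F_{\mathcal S})<1$, and for any $B_0\in\mathcal B^*(X)$ the sequence $(B_k)$ defined by $B_{k+1}=ev_{\mathcal S}(B_k)$ for $k\ge 0$ converges to $A_{\mathcal S}$ in $(\mathcal B^*(X),h)$.
   Context: $\mathcal B^*(X)$ (resp. $\mathcal K^*(X)$) is the set of nonempty closed bounded (resp. nonempty compact) subsets of $X$, with the Hausdorff-Pompeiu metric $h(A,B)=\max\{\sup_{x\in A}\inf_{y\in B}d(x,y),\ \sup_{y\in B}\inf_{x\in A}d(x,y)\}$. $X^m$ carries the maximum metric $d_m(x,y)=\max_{1\le i\le m}d(x_i,y_i)$; a map $\phi:X^m\to X$ is a Lipschitz contraction if its Lipschitz constant $\operatorname{Lip}(\phi)$ with respect to $d_m$ and $d$ is $<1$. A generalized iterated function system (GIFS) of order $m$ is a finite family of Lipschitz maps $\phi_j:X^m\to X$, $j=1,\dots,n$. Its generalized Hutchinson operator is $F_{\mathcal S}:\mathcal B^*(X)^m\to\mathcal B^*(X)$, $F_{\mathcal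 S}(A_1,\dots,A_m)=\overline{\bigcup_{j=1}^n\phi_j(A_1\times\cdots\times A_m)}$, and $\operatorname{Lip}(F_{\mathcal S})$ is its Lipschitz constant with respect to the maximum metric on $\mathcal B^*(X)^m$ (induced by $h$) and $h$. When $X$ is complete and the $\phi_j$ are Lipschitz contractions, it is known that there is a unique $A_{\mathcal S}\in\mathcal K^*(X)$ with $F_{\mathcal S}(A_{\mathcal S},\dots,A_{\mathcal S})=A_{\mathcal S}$; it is called the attractor of $\mathcal S$. An infinite iterated function system (IIFS) $\mathcal R=(X,(\psi_\theta)_{\theta\in\Theta})$ is a family of continuous maps $\psi_\theta:X\to X$ such that $\bigcup_{\theta}\psi_\theta(A)$ is bounded for each bounded $A\subset X$. Its fractal operator is $F_{\mathcal R}:\mathcal B^*(X)\to\mathcal B^*(X)$, $F_{\mathcal R}(A)=\overline{\bigcup_{\theta\in\Theta}\psi_\theta(A)}$. If $X$ is complete and $\sup_\theta\operatorname{Lip}(\psi_\theta)<1$, it is known that there is a unique $A_{\mathcal R}\in\mathcal B^*(X)$ with $F_{\mathcal R}(A_{\mathcal R})=A_{\mathcal R}$, called the attractor of $\mathcal R$. For $B\in\mathcal B^*(X)$, the IIFS induced by $B$ with respect to $\mathcal S$ is $\mathcal R_B=(X,(\psi_\theta)_{\theta\in\Theta})$ with $\Theta=B^{m-1}\times\{1,\dots,n\}$ and $\psi_\theta(x)=\phi_j(x,b_2,\dots,b_m)$ for $\theta=(b_2,\dots,b_m,j)$. It is bounded with $\sup_\theta\operatorname{Lip}(\psi_\theta)<1$,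 so it has an attractor $A_{\mathcal R_B}$. *)

(* Defs.v *)
From HB Require Import structures.
From mathcomp Require Import all_boot all_order all_algebra.
From mathcomp Require Import all_classical all_reals topology normedtype
  ereal sequences.
From mathcomp Require Import ring lra.

Set Implicit Arguments.
Unset Strict Implicit.
Unset Printing Implicit Defensive.

Import Order.TTheory GRing.Theory Num.Theory.
Import numFieldNormedType.Exports.

Local Open Scope classical_set_scope.
Local Open Scope ring_scope.

Section metric_notions.
Context {R : realType}.

Definition complete_metric (X : metricType R) : Prop :=
  forall u : nat -> X, cauchy (u @ \oo) -> exists l : X, u @ \oo --> l.

Definition mbounded {X : metricType R} (A : set X) : Prop :=
  exists M : R, forall x y, A x -> A y -> mdist x y <= M.

(* The least Lipschitz constant; +oo when f is not Lipschitz. *)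
Definition Lip {U V : metricType R} (f : U -> V) : \bar R :=
  ereal_inf [set C%:E | C in
    [set C : R | 0 <= C /\ forall x y, mdist (f x) (f y) <= C * mdist x y]].

Definition lipschitz_contraction {U V : metricType R} (f : U -> V) : Prop :=
  (Lip f < 1)%E.

Lemma Lip_ltP {U V : metricType R} (f : U -> V) (c : \bar R) : (Lip f < c)%E ->
  exists C : R, [/\ 0 <= C, (C%:E < c)%E &
    forall x y, mdist (f x) (f y) <= C * mdist x y].
Proof. by move=> /ereal_inf_lt[_ [C [C0 fC] <-] Cc]; exists C. Qed.

End metric_notions.

(* The maximum metric on X ^ m = {ffun 'I_m -> X}. *)
Section max_metric.
Context {R : realType} (I : finType) (X : metricType R).
Implicit Types x y z : {ffun I -> X}.

Definition maxdist x y : R := \big[Num.max/0]_(i : I) mdist (x i) (y i).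

Lemma le_maxdist x y i : mdist (x i) (y i) <= maxdist x y.
Proof. exact: (le_bigmax 0 (fun i => mdist (x i) (y i))). Qed.

Lemma maxdist_le x y (r : R) : 0 <= r -> (forall i, mdist (x i) (y i) <= r) ->
  maxdist x y <= r.
Proof. by move=> r0 xyr; apply: bigmax_le. Qed.

Lemma maxdist_ge0 x y : 0 <= maxdist x y.
Proof. by rewrite /maxdist; elim/big_rec: _ => // i r _ r0; rewrite le_max r0 orbT. Qed.

Lemma maxdistxx x : maxdist x x = 0.
Proof.
apply/le_anti; rewrite maxdist_ge0 andbT.
by apply: maxdist_le => // i; rewrite mdistxx.
Qed.

Lemma maxdist_positivity x y : maxdist x y = 0 -> x = y.
Proof.
move=> xy0; apply/ffunP => i; apply: mdist_positivity.
by apply/le_anti; rewrite mdist_ge0 andbT -xy0 le_maxdist.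
Qed.

Lemma maxdist_sym x y : maxdist x y = maxdist y x.
Proof. by apply: eq_bigr => i _; rewrite metric_sym. Qed.

Lemma maxdist_triangle y x z : maxdist x z <= maxdist x y + maxdist y z.
Proof.
apply: maxdist_le => [|i]; first by rewrite addr_ge0// maxdist_ge0.
by rewrite (le_trans (metric_triangle _ (y i) _))// lerD// le_maxdist.
Qed.

HB.instance Definition _ := isMetric.Build R {ffun I -> X}
  maxdistxx maxdist_positivity maxdist_sym maxdist_triangle.

End max_metric.

(* The space B^*(X) with the Hausdorff-Pompeiu metric. *)
Record bset {R : realType} (X : metricType R) := Bset {
  bset_set :> set X ;
  bset_nonempty : bset_set !=set0 ;
  bset_closed : closed bset_set ;
  bset_bounded : mbounded bset_set }.

HB.instance Definition _ (R : realType) (X : metricType R) :=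
  gen_eqMixin (bset X).
HB.instance Definition _ (R : realType) (X : metricType R) :=
  gen_choiceMixin (bset X).

Section hausdorff_pompeiu.
Context {R : realType} {X : metricType R}.
Implicit Types A B C : bset X.

Definition hdist A B : R := Num.max
  (sup [set inf [set mdist x y | y in (B : set X)] | x in (A : set X)])
  (sup [set inf [set mdist x y | x in (A : set X)] | y in (B : set X)]).

Lemma bset_eq A B : (A : set X) = B -> A = B.
Proof.
case: A B => [A a1 a2 a3] [B b1 b2 b3] /= AB; subst B.
by rewrite (Prop_irrelevance a1 b1) (Prop_irrelevance a2 b2)
  (Prop_irrelevance a3 b3).
Qed.

Lemma bset_bounded2 A B : exists M : R, forall x y, (A : set X) x -> (B : set X) y -> mdist x y <= M.
Proof.
have [[a Aa] [b Bb]] := (bset_nonempty A, bset_nonempty B).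
have [[M AM] [N BN]] := (bset_bounded A, bset_bounded B).
exists (M + mdist a b + N) => x y Ax By.
rewrite (le_trans (metric_triangle _ b _))// lerD// ?BN//.
by rewrite (le_trans (metric_triangle _ a _))// lerD// AM.
Qed.

Lemma hdist_sym A B : hdist A B = hdist B A.
Proof.
rewrite /hdist maxC; congr (Num.max (sup _) (sup _)).
- by congr image; apply/funext => x; congr (inf _); congr image;
    apply/funext => y; rewrite metric_sym.
- by congr image; apply/funext => x; congr (inf _); congr image;
    apply/funext => y; rewrite metric_sym.
Qed.

Let has_lbound_mdist (x : X) B : has_lbound [set mdist x y | y in (B : set X)].
Proof. by exists 0 => _ [y _ <-]; exact: mdist_ge0. Qed.

Lemma hdist_near A B x (e : R) : (A : set X) x -> 0 < e ->
  exists2 y, (B : set X) y & mdist x y < hdist A B + e.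
Proof.
move=> Ax e0.
have [||_ [y By <-] xy] := @inf_adherent _ [set mdist x y | y in (B : set X)] e.
- exact: e0.
- have [b Bb] := bset_nonempty B.
  by split; [exists (mdist x b), b|exact: has_lbound_mdist].
exists y => //; apply: (lt_le_trans xy); rewrite lerD2r le_max; apply/orP; left.
apply: ub_le_sup; last by exists x.
have [M ABM] := bset_bounded2 A B; exists M => _ [z Az <-].
have [b Bb] := bset_nonempty B.
apply: (@le_trans _ _ (mdist z b)); last exact: ABM.
by apply: ge_inf; [exact: has_lbound_mdist|exists b].
Qed.

Lemma hdist_le A B (r : R) :
  (forall x (e : R), (A : set X) x -> 0 < e ->
    exists2 y, (B : set X) y & mdist x y < r + e) ->
  (forall y (e : R), (B : set X) y -> 0 < e ->
    exists2 x, (A : set X) x & mdist x y < r + e) ->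
  hdist A B <= r.
Proof.
move=> AB BA; rewrite /hdist ge_max; apply/andP; split; apply: ge_sup.
- by have [a Aa] := bset_nonempty A; eexists; exists a.
- move=> _ [x Ax <-]; apply/ler_addgt0Pl => e e0; rewrite addrC.
  have [y By /ltW xy] := AB x e Ax e0; apply: (le_trans _ xy).
  by apply: ge_inf; [exact: has_lbound_mdist|exists y].
- by have [b Bb] := bset_nonempty B; eexists; exists b.
- move=> _ [y By <-]; apply/ler_addgt0Pl => e e0; rewrite addrC.
  have [x Ax /ltW xy] := BA y e By e0; apply: (le_trans _ xy).
  apply: ge_inf; last by exists x.
  by exists 0 => _ [z _ <-]; exact: mdist_ge0.
Qed.

Lemma hdist_ge0 A B : 0 <= hdist A B.
Proof.
apply/ler_addgt0Pl => e e0; rewrite addrC.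
have [a Aa] := bset_nonempty A.
have [b _ /ltW] := hdist_near B Aa e0.
by apply: le_trans; exact: mdist_ge0.
Qed.

Lemma hdistxx A : hdist A A = 0.
Proof.
apply/le_anti; rewrite hdist_ge0 andbT.
by apply: hdist_le => x e Ax e0; exists x => //; rewrite mdistxx add0r.
Qed.

Lemma hdist_positivity A B : hdist A B = 0 -> A = B.
Proof.
suff sub C D : hdist C D = 0 -> (C : set X) `<=` D.
  by move=> AB0; apply: bset_eq; apply/seteqP; split; apply: sub;
    rewrite // hdist_sym.
move=> CD0 x Cx; apply: (@bset_closed _ _ D) => V /nbhs_ballP[e /= e0 xeV].
have [y Dy] := hdist_near D Cx e0; rewrite CD0 add0r => xy.
by exists y; split => //; apply: xeV; rewrite ballEmdist.
Qed.

Lemma hdist_triangle B A C : hdist A C <= hdist A B + hdist B C.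
Proof.
have near A' B' C' x (e : R) : (A' : set X) x -> 0 < e ->
    exists2 z, (C' : set X) z & mdist x z < hdist A' B' + hdist B' C' + e.
  move=> Ax e0; have e20 : 0 < e / 2 by rewrite divr_gt0.
  have [y By xy] := hdist_near B' Ax e20.
  have [z Cz yz] := hdist_near C' By e20.
  exists z => //; apply: (le_lt_trans (metric_triangle _ y _)).
  by rewrite [e]splitr addrACA ltrD.
apply: hdist_le => [|z e Cz e0]; first exact: near.
have [x Ax zx] := near C B A z e Cz e0.
by exists x => //; rewrite metric_sym addrC [hdist _ _ + _]addrC addrC
  (hdist_sym A) (hdist_sym B).
Qed.

HB.instance Definition _ := isMetric.Build R (bset X)
  hdistxx hdist_positivity hdist_sym hdist_triangle.

End hausdorff_pompeiu.

Section complete_metric_lemmas.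
Context {R : realType} {X : metricType R}.
Hypothesis X_complete : complete_metric X.

Lemma geometric_cvg (u : nat -> X) (E c : R) : 0 <= E -> 0 <= c < 1 ->
    (forall k, mdist (u k) (u k.+1) <= E * (1 - c) * c ^+ k) ->
  exists2 l, u @ \oo --> l & forall n, mdist (u n) l <= E * c ^+ n.
Proof.
move=> E0 /andP[c0 c1] uc.
have cn0 n : 0 <= c ^+ n by rewrite exprn_ge0.
have und n k : mdist (u n) (u (n + k)%N) <= E * c ^+ n * (1 - c ^+ k).
  elim: k => [|k IH]; first by rewrite addn0 mdistxx expr0 subrr mulr0.
  rewrite addnS (le_trans (metric_triangle _ (u (n + k)%N) _))//.
  rewrite (le_trans (lerD IH (uc _)))// exprD exprS.
  by rewrite le_eqVlt; apply/orP; left; apply/eqP; ring.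
have unE n k : (n <= k)%N -> mdist (u n) (u k) <= E * c ^+ n.
  move=> /subnKC <-; rewrite (le_trans (und _ _))// ler_piMr ?mulr_ge0//.
  by rewrite lerBlDr lerDl.
have Ec0 : (fun n => E * c ^+ n) @ \oo --> (0 : R).
  by apply: cvg_geometric; rewrite ger0_norm.
have [|l ul] := X_complete (u := u).
  apply: cauchy_exP => e e0.
  have [n _ nE] := cvgr_lt _ Ec0 _ e0.
  exists (u n), n => // k /= nk; rewrite ballEmdist /=.
  by rewrite (le_lt_trans (unE _ _ nk))//; exact: (nE n (leqnn n)).
exists l => // n; apply/ler_addgt0Pr => e e0.
have [k _ kl] := metricType_numDomainType.cvgr_dist_lt ul e0.
rewrite (le_trans (metric_triangle _ (u (maxn n k)) _))// lerD//.
  by rewrite unE// leq_maxl.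
by rewrite metric_sym ltW//; exact: (kl (maxn n k) (leq_maxr n k)).
Qed.

Lemma contraction_fixpoint (f : X -> X) (c : R) (x0 : X) : 0 <= c < 1 ->
    (forall x y, mdist (f x) (f y) <= c * mdist x y) ->
  exists2 x, f x = x & forall y, f y = y -> y = x.
Proof.
move=> /[dup] c01 /andP[c0 c1] fc.
pose u k := iter k f x0; pose E := mdist x0 (f x0) / (1 - c).
have c1' : 0 < 1 - c by rewrite subr_gt0.
have uc k : mdist (u k) (u k.+1) <= E * (1 - c) * c ^+ k.
  rewrite /E divfK ?gt_eqF//; elim: k => [|k IH]; first by rewrite expr0 mulr1.
  rewrite (le_trans (fc _ _))//= exprS mulrCA ler_wpM2l//.
have [l _ ul] := geometric_cvg (divr_ge0 (mdist_ge0 _ _) (ltW c1')) c01 uc.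
have fl : f l = l.
  apply/esym/mdist_positivity/le_anti; rewrite mdist_ge0 andbT.
  have Ec0 : (fun n => (E + E) * c ^+ n) @ \oo --> (0 : R).
    by apply: cvg_geometric; rewrite ger0_norm.
  apply/ler_addgt0Pl => e e0; rewrite addr0.
  have [n _ /(_ n (leqnn n)) /= nE] := cvgr_lt _ Ec0 _ e0.
  apply: le_trans (ltW nE); rewrite (le_trans (metric_triangle _ (u n.+1) _))//.
  rewrite mulrDl lerD//.
    rewrite metric_sym (le_trans (ul _))// exprS ler_wpM2l//.
      by rewrite divr_ge0 ?mdist_ge0// ltW.
    by rewrite ler_piMl ?exprn_ge0// ltW.
  rewrite (le_trans (fc _ _))// (le_trans _ (ul n))//.
  by rewrite ler_piMl ?mdist_ge0// ltW.
exists l => // y fy; apply/mdist_positivity/le_anti; rewrite mdist_ge0 andbT.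
by rewrite -(pmulr_rle0 _ c1') mulrBl mul1r subr_le0 -[in leLHS]fy -[in leLHS]fl.
Qed.

Lemma bset_complete : complete_metric (bset X).
Proof.
move=> u /cauchy_ballP u_cauchy.
have uN (e : R) : 0 < e -> exists N, forall i j, (N <= i)%N -> (N <= j)%N ->
    hdist (u i) (u j) < e.
  move=> /u_cauchy [[P Q] [[N _ NP] [M _ MQ]] PQ].
  exists (maxn N M) => i j; rewrite !geq_max => /andP[Ni _] /andP[_ Mj].
  have := PQ (u i, u j); rewrite /= ballEmdist; apply; split => /=.
    exact: NP.
  exact: MQ.
pose L : set X := [set x | forall (e : R) N, 0 < e -> exists n, (N <= n)%N /\
  exists2 a, (u n : set X) a & mdist x a < e].
have uL (e : R) N n x : 0 < e ->
    (forall i j, (N <= i)%N -> (N <= j)%N -> hdist (u i) (u j) < e) ->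
    (N <= n)%N -> L x -> exists2 a, (u n : set X) a & mdist x a < e *+ 3.
  move=> e0 Ne Nn Lx; have [i [Ni [a ua xa]]] := Lx e N e0.
  have [b ub ab] := hdist_near (u n) ua e0.
  exists b => //; rewrite (le_lt_trans (metric_triangle _ a _))//.
  have := Ne i n Ni Nn; rewrite !mulrS mulr0n; lra.
have Lu (e : R) N n a : 0 < e ->
    (forall i j, (N <= i)%N -> (N <= j)%N -> hdist (u i) (u j) < e) ->
    (N <= n)%N -> (u n : set X) a -> exists2 x, L x & mdist x a <= e *+ 4.
  move=> e0 Ne Nn ua.
  have ek0 k : 0 < e * 2^-1 ^+ k by rewrite mulr_gt0// exprn_gt0// invr_gt0.
  have /choice[K KP] k := uN _ (ek0 k).
  pose K' k := if k is 0%N then N else K k.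
  have K'P k i j : (K' k <= i)%N -> (K' k <= j)%N ->
      hdist (u i) (u j) < e * 2^-1 ^+ k.
    by case: k => [|k]; [rewrite expr0 mulr1; exact: Ne|exact: KP].
  pose ix k := (n + \sum_(j < k) (K' j.+1).+1)%N.
  have ixS k : ix k.+1 = (ix k + (K' k.+1).+1)%N by rewrite /ix big_ord_recr addnA.
  have K'ix k : (K' k <= ix k)%N.
    case: k => [|k]; first by rewrite /ix big_ord0 addn0.
    by rewrite ixS (leq_trans (leqnSn _))// leq_addl.
  have ixk k : (k <= ix k)%N.
    by elim: k => // k IH; rewrite ixS addnS ltnS (leq_trans IH)// leq_addr.
  have /choice[f fP] (p : nat * X) : exists y, (u (ix p.1) : set X) p.2 ->
      (u (ix p.1.+1) : set X) y /\ mdist p.2 y <= (e *+ 4) * (1 - 2^-1) * 2^-1 ^+ p.1.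
    have [up|?] := pselect ((u (ix p.1) : set X) p.2); last by exists p.2.
    have [y uy py] := hdist_near (u (ix p.1.+1)) up (ek0 p.1).
    exists y => _; split => //; rewrite (le_trans (ltW py))//.
    have /(_ (K'ix _)) := @K'P p.1 (ix p.1) (ix p.1.+1).
    rewrite ixS => /(_ (leq_trans (K'ix _) (leq_addr _ _))).
    have -> : e *+ 4 * (1 - 2^-1) = e + e by rewrite !mulrS mulr0n; field.
    by move=> hq; rewrite mulrDl lerD2r ltW.
  pose v := fix v k := if k is k'.+1 then f (k', v k') else a.
  have uv k : (u (ix k) : set X) (v k).
    elim: k => [|k IH]; first by rewrite /ix big_ord0 addn0.
    by have [] := fP (k, v k) IH.
  have [|||l vl al] := @geometric_cvg v (e *+ 4) 2^-1.
  - by rewrite mulrn_wge0// ltW.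
  - by rewrite invr_ge0 ler0n invf_lt1// ltr1n.
  - by move=> k; have [] := fP (k, v k) (uv k).
  exists l; last by have := al 0%N; rewrite expr0 mulr1 metric_sym.
  move=> d M d0; have [k _ kl] := metricType_numDomainType.cvgr_dist_lt vl d0.
  exists (ix (maxn k M)); split; first by rewrite (leq_trans _ (ixk _))// leq_maxr.
  by exists (v (maxn k M)) => //; exact: (kl (maxn k M) (leq_maxl _ _)).
have [N N1] := uN 1 ltr01.
have L0 : L !=set0.
  have [a ua] := bset_nonempty (u N).
  by have [x Lx _] := Lu 1 N N a ltr01 N1 (leqnn N) ua; exists x.
have Lb : mbounded L.
  have [M uM] := bset_bounded (u N); exists (3 + M + 3) => x y Lx Ly.
  have [a ua xa] := uL 1 N N x ltr01 N1 (leqnn N) Lx.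
  have [b ub yb] := uL 1 N N y ltr01 N1 (leqnn N) Ly.
  have := metric_triangle x a y; have := metric_triangle a b y.
  have := uM a b ua ub; rewrite (metric_sym b); lra.
have Lc : closed L.
  move=> x Lx e M e0; have e20 : 0 < e / 2 by rewrite divr_gt0.
  have [y [Ly]] := Lx _ (nbhsx_ballx x _ e20); rewrite ballEmdist /= => xy.
  have [n [Mn [a ua ya]]] := Ly (e / 2) M e20.
  exists n; split => //; exists a => //.
  by rewrite (le_lt_trans (metric_triangle _ y _))// [e]splitr ltrD.
exists (Bset L0 Lc Lb); apply/metricType_numDomainType.cvgrPdist_le => e e0.
have e40 : 0 < e / 4 by rewrite divr_gt0.
have [M Me] := uN _ e40; exists M => // n /= Mn.
have h4 : e / 4 *+ 4 = e by rewrite -mulr_natr divfK// pnatr_eq0.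
apply: hdist_le => /= [x d Lx d0|a d ua d0].
- have [a ua xa] := uL _ _ _ _ e40 Me Mn Lx; exists a => //.
  by rewrite (lt_trans xa)// -[in ltRHS]h4 [in ltRHS]mulrSr -addrA ltrDl addr_gt0.
- have [x Lx xa] := Lu _ _ _ _ e40 Me Mn ua; exists x => //.
  by rewrite h4 in xa; rewrite (le_lt_trans xa)// ltrDl.
Qed.

End complete_metric_lemmas.

Section bset_closure.
Context {R : realType} {X : metricType R}.

Lemma mbounded_closure (A : set X) : mbounded A -> mbounded (closure A).
Proof.
move=> [M AM]; exists M => x y Ax Ay; apply/ler_addgt0Pl => e e0.
have e20 : 0 < e / 2 by rewrite divr_gt0.
have [x' [Ax']] := Ax _ (nbhsx_ballx x _ e20); rewrite ballEmdist /= => xx'.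
have [y' [Ay']] := Ay _ (nbhsx_ballx y _ e20); rewrite ballEmdist /= => yy'.
have xy : mdist x y <= mdist x x' + mdist x' y' + mdist y y'.
  rewrite (le_trans (metric_triangle _ y' _))// [mdist y y']metric_sym.
  by rewrite lerD// metric_triangle.
by have := AM _ _ Ax' Ay'; lra.
Qed.

Definition bset_closure (A : set X) (A0 : A !=set0) (Ab : mbounded A) : bset X :=
  Bset (let: ex_intro a Aa := A0 in ex_intro _ a (subset_closure Aa))
    (@closed_closure _ A) (mbounded_closure Ab).

End bset_closure.

(* Coordinates and maps are indexed from 0. The Hutchinson operator needs at
   least one map to have nonempty values, hence gifs X m n.+1 below. *)
Section gifs.
Context {R : realType} (X : metricType R).

Record gifs (m n : nat) := Gifs {
  gifs_map :> 'I_n -> (X ^ m)%type -> X ;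
  gifs_lipschitz : forall j, (Lip (gifs_map j) < +oo)%E }.

Definition prod_set m (A : (bset X ^ m)%type) : set (X ^ m)%type :=
  [set x | forall i, (A i : set X) (x i)].

Definition gifs_union m n (S : gifs m n) (A : (bset X ^ m)%type) : set X :=
  \bigcup_(j : 'I_n) (S j @` prod_set A).

Lemma gifs_union_nonempty m n (S : gifs m n.+1) A : gifs_union S A !=set0.
Proof.
have /choice[f Af] i : exists x, (A i : set X) x by exact: bset_nonempty.
exists (S ord0 [ffun i => f i]), ord0 => //; exists [ffun i => f i] => //.
by move=> i; rewrite ffunE.
Qed.

Lemma gifs_image_bounded m n (S : gifs m n) (U : set (X ^ m)%type) :
  mbounded U -> mbounded (\bigcup_(j : 'I_n) (S j @` U)).
Proof.
move=> [M UM].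
have [[u0 Uu0]|U0] := pselect (U !=set0); last first.
  by exists 0 => ? ? [j _ [u Uu _]]; exfalso; apply: U0; exists u.
have /choice[C CP] j : exists C : R, 0 <= C /\
    forall u v, mdist (S j u) (S j v) <= C * mdist u v.
  by have [C [C0 _ SC]] := Lip_ltP (gifs_lipschitz S j); exists C.
have M0 : 0 <= M by rewrite (le_trans (mdist_ge0 u0 u0))// UM.
pose K := \big[Num.max/0]_(j : 'I_n) C j.
pose L := \big[Num.max/0]_(p : 'I_n * 'I_n) mdist (S p.1 u0) (S p.2 u0).
have SK j u v : U u -> U v -> mdist (S j u) (S j v) <= K * M.
  move=> Uu Uv; have [C0 SC] := CP j; rewrite (le_trans (SC _ _))//.
  by rewrite ler_pM ?mdist_ge0 ?UM//; exact: (le_bigmax 0 C).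
exists (K * M + L + K * M) => _ _ [i _ [u Uu <-]] [j _ [v Uv <-]].
rewrite (le_trans (metric_triangle _ (S j u0) _))// lerD ?SK//.
rewrite (le_trans (metric_triangle _ (S i u0) _))// lerD ?SK//.
exact: (le_bigmax 0 (fun p => mdist (S p.1 u0) (S p.2 u0)) (i, j)).
Qed.

Lemma prod_set_bounded m (A : (bset X ^ m)%type) : mbounded (prod_set A).
Proof.
have /choice[M AM] i : exists M : R,
    forall x y, (A i : set X) x -> (A i : set X) y -> mdist x y <= M.
  exact: bset_bounded.
exists (\big[Num.max/0]_i M i) => x y Ax Ay.
apply: maxdist_le => [|i]; last first.
  by rewrite (le_trans (AM i _ _ (Ax i) (Ay i)))//; exact: (le_bigmax 0 M).
by elim/big_rec: _ => // i r _ r0; rewrite le_max r0 orbT.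
Qed.

Lemma gifs_union_bounded m n (S : gifs m n) A : mbounded (gifs_union S A).
Proof. exact/gifs_image_bounded/prod_set_bounded. Qed.

(* F_S; [ffun=> A] is the tuple (A, ..., A). *)
Definition gifs_op m n (S : gifs m n.+1) (A : (bset X ^ m)%type) : bset X :=
  bset_closure (gifs_union_nonempty S A) (gifs_union_bounded S A).

Definition gifs_attractor m n (S : gifs m n.+1) (A : bset X) : Prop :=
  compact (A : set X) /\ gifs_op S [ffun=> A] = A.

End gifs.

Section iifs.
Context {R : realType} (X : metricType R).

Record iifs := Iifs {
  iifs_index : Type ;
  iifs_map :> iifs_index -> X -> X ;
  iifs_index_inhabited : inhabited iifs_index ;
  iifs_continuous : forall t, continuous (iifs_map t) ;
  iifs_bounded : forall A : set X, mbounded A ->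
    mbounded (\bigcup_t (iifs_map t @` A)) }.

Definition iifs_union (r : iifs) (A : set X) : set X := \bigcup_t (r t @` A).

Lemma iifs_union_nonempty (r : iifs) (A : bset X) : iifs_union r A !=set0.
Proof.
have [[a Aa] [t]] := (bset_nonempty A, iifs_index_inhabited r).
by exists (r t a), t => //; exists a.
Qed.

(* F_R *)
Definition iifs_op (r : iifs) (A : bset X) : bset X :=
  bset_closure (iifs_union_nonempty r A) (iifs_bounded r (bset_bounded A)).

Definition iifs_attractor (r : iifs) (A : bset X) : Prop := iifs_op r A = A.

Lemma iifs_op_mdist (r : iifs) (c : R) : 0 <= c ->
    (forall t x y, mdist (r t x) (r t y) <= c * mdist x y) ->
  forall A B, mdist (iifs_op r A) (iifs_op r B) <= c * mdist A B.
Proof.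
move=> c0 rc.
have near (A B : bset X) x (e : R) : (iifs_op r A : set X) x -> 0 < e ->
    exists2 y, (iifs_op r B : set X) y & mdist x y < c * hdist A B + e.
  move=> FAx e0; have e20 : 0 < e / 2 by rewrite divr_gt0.
  have [x' [[t _ [a Aa <-]]]] := FAx _ (nbhsx_ballx x _ e20).
  rewrite ballEmdist /= => xa.
  have c1 : 0 < c + 1 by rewrite ltr_wpDl.
  have [b Bb ab] := hdist_near B Aa (divr_gt0 e20 c1).
  exists (r t b); first by apply: subset_closure; exists t => //; exists b.
  rewrite (le_lt_trans (metric_triangle _ (r t a) _))//.
  have rab : mdist (r t a) (r t b) <= c * hdist A B + e / 2.
    rewrite (le_trans (rc _ _ _))// (le_trans (ler_wpM2l c0 (ltW ab)))//.
    rewrite mulrDr lerD2l mulrCA ler_piMr ?(ltW e20)//.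
    by rewrite ler_pdivrMr// mul1r lerDl.
  lra.
move=> A B; apply: hdist_le => [x e|y e FBy e0]; first exact: near.
have [x FAx yx] := near B A y e FBy e0.
by exists x => //; rewrite metric_sym [mdist A B]hdist_sym.
Qed.

Lemma iifs_attractor_exists (r : iifs) (c : R) (A0 : bset X) :
    complete_metric X -> 0 <= c < 1 ->
    (forall t x y, mdist (r t x) (r t y) <= c * mdist x y) ->
  exists2 A, iifs_attractor r A & forall A', iifs_attractor r A' -> A' = A.
Proof.
move=> Xc c01 rc; apply: (contraction_fixpoint (bset_complete Xc) A0 c01).
by apply: iifs_op_mdist => //; case/andP: c01.
Qed.

End iifs.

Section induced.
Context {R : realType} (X : metricType R) (m n : nat).
Variables (S : gifs X m.+1 n.+1) (B : bset X).

(* (x, b_2, ..., b_m) *)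
Definition cons_point (x : X) (b : (B ^ m)%type) : (X ^ m.+1)%type :=
  [ffun i => if unlift ord0 i is Some k then \val (b k) else x].

Definition induced_index : Type := ((B ^ m) * 'I_n.+1)%type.

Definition induced_map (t : induced_index) (x : X) : X :=
  S t.2 (cons_point x t.1).

Lemma cons_point_mdist x y b : mdist (cons_point x b) (cons_point y b) <= mdist x y.
Proof.
apply: maxdist_le => [|i]; first exact: mdist_ge0.
by rewrite !ffunE; case: unliftP => [k _|_] //; rewrite mdistxx mdist_ge0.
Qed.

Lemma induced_map_mdist t C : 0 <= C ->
    (forall u v, mdist (S t.2 u) (S t.2 v) <= C * mdist u v) ->
  forall x y, mdist (induced_map t x) (induced_map t y) <= C * mdist x y.
Proof.
move=> C0 SC x y; rewrite (le_trans (SC _ _))//.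
by rewrite ler_wpM2l// cons_point_mdist.
Qed.

Lemma induced_inhabited : inhabited induced_index.
Proof.
have [b Bb] := bset_nonempty B.
exact: (inhabits ([ffun=> SigSub (mem_set Bb)], ord0)).
Qed.

Lemma induced_continuous t : continuous (induced_map t).
Proof.
have [C [C0 _ SC]] := Lip_ltP (gifs_lipschitz S t.2).
have {}SC := induced_map_mdist C0 SC.
move=> x; apply/metricType_numDomainType.cvgrPdist_le => e e0.
have C1 : 0 < C + 1 by rewrite ltr_wpDl.
near=> y; rewrite (le_trans (SC _ _))//.
rewrite (@le_trans _ _ ((C + 1) * mdist x y))//.
  by rewrite ler_wpM2r ?mdist_ge0// lerDl.
rewrite mulrC -ler_pdivlMr// ltW//.
suff yx : ball x (e / (C + 1)) y by rewrite ballEmdist in yx.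
by near: y; apply: nbhsx_ballx; rewrite divr_gt0.
Unshelve. all: by end_near. Qed.

Lemma induced_bounded (A : set X) : mbounded A ->
  mbounded (\bigcup_t (induced_map t @` A)).
Proof.
move=> [M AM]; have [N BN] := bset_bounded B.
pose U := [set u | exists x (b : (B ^ m)%type), A x /\ u = cons_point x b].
have /(gifs_image_bounded S)[K SK] : mbounded U.
  exists (Num.max 0 (Num.max M N)) => _ _ [x [b [Ax ->]]] [y [c [Ay ->]]].
  apply: maxdist_le => [|i]; first by rewrite le_max lexx.
  rewrite !ffunE; case: unliftP => [k _|_]; rewrite !le_max.
    by rewrite BN ?orbT//; exact: set_valP.
  by rewrite AM ?orbT.
exists K => _ _ [s _ [x Ax <-]] [t _ [y Ay <-]]; apply: SK.
- by exists s.2 => //; exists (cons_point x s.1) => //; exists x, s.1.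
- by exists t.2 => //; exists (cons_point y t.1) => //; exists y, t.1.
Qed.

(* R_B *)
Definition induced : iifs X :=
  Iifs induced_inhabited induced_continuous induced_bounded.

End induced.

Section evaluation_map.
Context {R : realType} (X : metricType R) (m n : nat).
Variable S : gifs X m.+1 n.+1.

(* A_{R_B}; the default value B of xget is never used, see evP. *)
Definition ev (B : bset X) : bset X := xget B (iifs_attractor (induced S B)).

Lemma evP (B : bset X) : complete_metric X ->
    (forall j, lipschitz_contraction (S j)) ->
  iifs_attractor (induced S B) (ev B) /\
  forall A, iifs_attractor (induced S B) A -> A = ev B.
Proof.
move=> Xc Sc.
have /choice[C CP] j : exists C : R, [/\ 0 <= C, (C%:E < 1)%E &
    forall u v, mdist (S j u) (S j v) <= C * mdist u v] by exact: Lip_ltP (Sc j).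
pose c := \big[Num.max/0]_j C j.
have c01 : 0 <= c < 1.
  apply/andP; split.
    by rewrite /c; elim/big_rec: _ => // i r _ r0; rewrite le_max r0 orbT.
  by apply: bigmax_lt => // j _; have [_ + _] := CP j; rewrite lte_fin.
have Rc t x y :
    mdist (induced S B t x) (induced S B t y) <= c * mdist x y.
  have [C0 _ SC] := CP t.2; rewrite (le_trans (induced_map_mdist C0 SC _ _))//.
  by rewrite ler_wpM2r ?mdist_ge0//; exact: (le_bigmax 0 C).
have [A FA Au] := iifs_attractor_exists B Xc c01 Rc.
have evA : iifs_attractor (induced S B) (ev B).
  by rewrite /ev; case: xgetP => [? _ //|/(_ A)].
by split => // A' FA'; rewrite (Au _ FA') (Au _ evA).
Qed.

End evaluation_map.

(* Main.v *)
Require Import Defs.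
From mathcomp Require Import all_boot all_order all_algebra.
From mathcomp Require Import all_classical all_reals topology normedtype.
From mathcomp Require Import ereal sequences.
From mathcomp Require Import lra.

(** Write F_S for the generalized Hutchinson operator of S. Since the maps of
    the system R_B are the phi_j with all arguments but the first fixed in B,
    the fractal operator of R_B is A |-> F_S (A, B, ..., B)
    ([iifs_op_induced]). Thus ev B is the unique solution A of the implicit
    equation F_S (A, B, ..., B) = A.

    If F_S is C-Lipschitz with C < 1, then comparing the equations of ev B and
    ev B' gives
      h (ev B, ev B') <= C max (h (ev B, ev B'), h (B, B')),
    and C < 1 forbids the maximum to be the first term unless that term is 0;
    hence ev is C-Lipschitz ([ev_mdist]), which gives Lip ev <= Lip F_S. That
    Lip F_S < 1 holds because F_S is Lipschitz for the largest of the constants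
    of the finitely many phi_j ([gifs_op_mdist], [gifs_contraction_const]).

    Finally F_S (A_S, A_S, ..., A_S) = A_S is the implicit equation for B = A_S,
    so that A_S is a fixed point of the contraction ev and attracts every orbit
    ([contraction_orbit_cvg]). *)

Set Implicit Arguments.
Unset Strict Implicit.
Unset Printing Implicit Defensive.

Import Order.TTheory GRing.Theory Num.Theory.
Import numFieldNormedType.Exports.

Local Open Scope classical_set_scope.
Local Open Scope ring_scope.

Section lipschitz.
Context {R : realType}.

Lemma Lip_le {U V : metricType R} (f : U -> V) (C : R) : 0 <= C ->
  (forall x y, mdist (f x) (f y) <= C * mdist x y) -> (Lip f <= C%:E)%E.
Proof. by move=> C0 fC; apply: ereal_inf_lbound; exists C. Qed.

Lemma contraction_orbit_cvg {U : metricType R} (f : U -> U) (C : R) (p : U)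
    (u : nat -> U) : 0 <= C < 1 ->
    (forall x y, mdist (f x) (f y) <= C * mdist x y) -> f p = p ->
    (forall k, u k.+1 = f (u k)) -> u @ \oo --> p.
Proof.
move=> /andP[C0 C1] fC fp uS.
have up k : mdist p (u k) <= mdist p (u 0%N) * C ^+ k.
  elim: k => [|k IH]; first by rewrite expr0 mulr1.
  rewrite uS -[in leLHS]fp (le_trans (fC _ _))// exprS mulrCA.
  by rewrite ler_wpM2l.
have geo0 : (fun k => mdist p (u 0%N) * C ^+ k) @ \oo --> (0 : R).
  by apply: cvg_geometric; rewrite ger0_norm.
apply/metricType_numDomainType.cvgrPdist_le => e e0.
have [N _ Ne] := cvgr_lt _ geo0 _ e0.
exists N => // k /= Nk.
by rewrite (le_trans (up k))// ltW//; exact: Ne.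
Qed.

End lipschitz.

Section hutchinson.
Context {R : realType} (X : metricType R).

(** The strict excess e allowed by [hdist_near] is split between leaving the
    closure and choosing, coordinate by coordinate, a near point of the other
    tuple of sets; the latter share is divided by c + 1 so that it survives the
    multiplication by c. *)
Lemma gifs_op_mdist (m n : nat) (S : gifs X m n.+1) (c : R) : 0 <= c ->
    (forall j u v, mdist (S j u) (S j v) <= c * mdist u v) ->
  forall A B, mdist (gifs_op S A) (gifs_op S B) <= c * mdist A B.
Proof.
move=> c0 Sc.
have near (A B : (bset X ^ m)%type) x (e : R) :
    (gifs_op S A : set X) x -> 0 < e ->
    exists2 y, (gifs_op S B : set X) y & mdist x y < c * mdist A B + e.
  move=> FAx e0; have e20 : 0 < e / 2 by rewrite divr_gt0.
  have [x' [[j _ [u Au <-]]]] := FAx _ (nbhsx_ballx x _ e20).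
  rewrite ballEmdist /= => xu.
  have c1 : 0 < c + 1 by rewrite ltr_wpDl.
  pose d := e / 2 / (c + 1).
  have d0 : 0 < d by rewrite divr_gt0.
  have /choice[v Bv] i : exists y, (B i : set X) y /\
      mdist (u i) y < mdist (A i) (B i) + d.
    by have [y By uy] := hdist_near (B i) (Au i) d0; exists y.
  exists (S j [ffun i => v i]).
    apply: subset_closure; exists j => //; exists [ffun i => v i] => // i.
    by rewrite ffunE; have [] := Bv i.
  have uv : mdist u [ffun i => v i] <= mdist A B + d.
    apply: maxdist_le => [|i]; first by rewrite addr_ge0 ?mdist_ge0// ltW.
    rewrite ffunE; have [_ /ltW uvi] := Bv i.
    by rewrite (le_trans uvi)// lerD2r le_maxdist.
  have cd : c * d <= e / 2.
    by rewrite /d mulrCA ler_piMr ?(ltW e20)// ler_pdivrMr// mul1r lerDl.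
  have := metric_triangle x (S j u) (S j [ffun i => v i]).
  have := Sc j u [ffun i => v i]; have := ler_wpM2l c0 uv.
  rewrite mulrDr; lra.
move=> A B; apply: hdist_le => [x e|y e FBy e0]; first exact: near.
have [x FAx yx] := near B A y e FBy e0.
by exists x => //; rewrite metric_sym [mdist A B]metric_sym.
Qed.

Lemma gifs_contraction_const (m n : nat) (S : gifs X m n) :
    (forall j, lipschitz_contraction (S j)) ->
  exists2 c : R, 0 <= c < 1 &
    forall j u v, mdist (S j u) (S j v) <= c * mdist u v.
Proof.
move=> Sc.
have /choice[C CP] j : exists C : R, [/\ 0 <= C, (C%:E < 1)%E &
    forall u v, mdist (S j u) (S j v) <= C * mdist u v] by exact: Lip_ltP (Sc j).
exists (\big[Num.max/0]_j C j).
  apply/andP; split.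
    by elim/big_rec: _ => // i r _ r0; rewrite le_max r0 orbT.
  by apply: bigmax_lt => // j _; have [_ + _] := CP j; rewrite lte_fin.
move=> j u v; have [_ _ SC] := CP j; rewrite (le_trans (SC _ _))//.
by rewrite ler_wpM2r ?mdist_ge0//; exact: (le_bigmax 0 C).
Qed.

End hutchinson.

Section evaluation.
Context {R : realType} (X : metricType R) (m n : nat) (S : gifs X m.+1 n.+1).

(** The tuple (A, B, ..., B), shaped like [cons_point]. *)
Definition cons_bset (A B : bset X) : (bset X ^ m.+1)%type :=
  [ffun i => if unlift ord0 i is Some _ then B else A].

Lemma cons_bset_diag (A : bset X) : cons_bset A A = [ffun=> A].
Proof. by apply/ffunP => i; rewrite !ffunE; case: unliftP. Qed.

Lemma cons_bset_mdist (A A' B B' : bset X) :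
  mdist (cons_bset A B) (cons_bset A' B') <= Num.max (mdist A A') (mdist B B').
Proof.
apply: maxdist_le => [|i]; first by rewrite le_max mdist_ge0.
by rewrite !ffunE; case: unliftP => [k _|_]; rewrite le_max lexx ?orbT.
Qed.

(** A point of A x B x ... x B is exactly a point of A together with the
    parameters in B that index one map of R_B for each phi_j, so that both
    operators close the same union. *)
Lemma iifs_op_induced (A B : bset X) :
  iifs_op (induced S B) A = gifs_op S (cons_bset A B).
Proof.
apply: bset_eq; congr closure; apply/seteqP; split => x.
- move=> [[b j] _ [a Aa <-]]; exists j => //; exists (cons_point a b) => // i.
  by rewrite !ffunE; case: unliftP => [k _|_] //; exact: set_valP.
- move=> [j _ [u ABu <-]].
  have uB k : u (lift ord0 k) \in (B : set X).
    by apply/mem_set; have := ABu (lift ord0 k); rewrite ffunE liftK.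
  exists ([ffun k => SigSub (uB k)], j) => //; exists (u ord0).
    by have := ABu ord0; rewrite ffunE unlift_none.
  congr (S j _); apply/ffunP => i.
  by rewrite ffunE; case: unliftP => [k ->|->] //; rewrite ffunE.
Qed.

Hypotheses (X_complete : complete_metric X)
  (S_contraction : forall j, lipschitz_contraction (S j)).

Lemma ev_implicit (B : bset X) : gifs_op S (cons_bset (ev S B) B) = ev S B.
Proof. by rewrite -iifs_op_induced; have [] := evP B X_complete S_contraction. Qed.

Lemma ev_diag_fixed (A : bset X) : gifs_op S [ffun=> A] = A -> ev S A = A.
Proof.
move=> FA; have [_ ev_unique] := evP A X_complete S_contraction.
by apply/esym/ev_unique; rewrite /iifs_attractor iifs_op_induced cons_bset_diag.
Qed.

(** The Lipschitz constant of F_S passes to ev unchanged because the maximum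
    metric does not add up the two distances in [cons_bset_mdist]. *)
Lemma ev_mdist (C : R) : 0 <= C < 1 ->
    (forall A B, mdist (gifs_op S A) (gifs_op S B) <= C * mdist A B) ->
  forall B B', mdist (ev S B) (ev S B') <= C * mdist B B'.
Proof.
move=> /andP[C0 C1] FC B B'; set r := mdist (ev S B) _.
have rmax : r <= C * Num.max r (mdist B B').
  rewrite /r -{1}(ev_implicit B) -{1}(ev_implicit B') (le_trans (FC _ _))//.
  by rewrite ler_wpM2l// cons_bset_mdist.
have [r_small|r_big] := leP r (mdist B B').
  by move: rmax; rewrite (max_idPr r_small).
(* here r <= C r, which is absurd for r > h (B, B') >= 0 *)
have r0 : 0 < r by rewrite (le_lt_trans _ r_big)// mdist_ge0.
move: rmax; rewrite (max_idPl (ltW r_big)).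
by rewrite -[leLHS]mul1r ler_pM2r// leNgt C1.
Qed.

End evaluation.

Theorem theorem3p6 (R : realType) (X : metricType R) (m n : nat)
    (S : gifs X m.+2 n.+1) (AS : bset X) :
  complete_metric X ->
  (forall j : 'I_n.+1, lipschitz_contraction (S j)) ->
  gifs_attractor S AS ->
  [/\ lipschitz_contraction (ev S),
      (Lip (ev S) <= Lip (gifs_op S))%E,
      (Lip (gifs_op S) < 1)%E &
      forall B : nat -> bset X,
        (forall k, B k.+1 = ev S (B k)) -> B @ \oo --> AS].
Proof.
move=> Xc Sc [_ FAS].
have [c c01 SC] := gifs_contraction_const Sc.
have /andP[c0 c1] := c01.
have Fc := gifs_op_mdist c0 SC.
have evc := ev_mdist Xc Sc c01 Fc.
have LipF1 : (Lip (gifs_op S) < 1)%E.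
  by rewrite (le_lt_trans (Lip_le c0 Fc))// lte_fin.
have Lip_ev_F : (Lip (ev S) <= Lip (gifs_op S))%E.
  apply: le_ereal_inf_tmp => _ [C [C0 FC] <-].
  have [C1|C1] := ltP C 1.
    by apply: Lip_le => //; apply: ev_mdist => //; rewrite C0.
  (* a constant C >= 1 exceeds the constant c < 1 of ev *)
  by rewrite (le_trans (Lip_le c0 evc))// lee_fin (le_trans (ltW c1)).
split => //; first exact: le_lt_trans Lip_ev_F LipF1.
move=> B BS; apply: contraction_orbit_cvg c01 evc _ BS.
exact: ev_diag_fixed.
Qed.
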